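(* Let $X$ be a $T_2$ (Hausdorff) topological space which contains an uncountable closed discrete set. Then the hyperspace $(CL(X),\tau_F)$ of nonempty closed subsets of $X$ equipped with the Fell topology contains a copy of $(\omega_1+1)^{\omega}$ and a copy of $(\omega_1+1)^{\omega_1}$; that is, each of these two spaces is homeomorphic to a subspace of $(CL(X),\tau_F)$.
   Context: $CL(X)$ denotes the family of all nonempty closed subsets of $X$. For $M\subseteq X$ put $M^-=\{A\in CL(X): A\cap M\neq\emptyset\}$, $M^+=\{A\in CL(X): A\subseteq M\}$ and $M^c=X\setminus M$. The Fell topology $\tau_F$ on $CL(X)$ has as a subbase the collection $\{U^-: U \text{ open in } X\}\cup\{(K^c)^+: K \text{ compact in } X\}$. The ordinal $\omega_1+1=[0,\omega_1]$ carries the order topology, and the powers $(\omega_1+1)^{\omega}$ and $(\omega_1+1)^{\omega_1}$ carry the product topology. *)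

(* Defs.v *)
From HB Require Import structures.
From mathcomp Require Import all_boot all_order.
From mathcomp Require Import wochoice all_classical topology.

Set Implicit Arguments.
Unset Strict Implicit.
Unset Printing Implicit Defensive.

Import Order.TTheory.
Local Open Scope classical_set_scope.

(* The discreteness of D refers to the subspace topology on D. *)
Definition discrete_subset (X : topologicalType) (D : set X) : Prop :=
  forall B : set (set_type D), open B.

Definition homeomorphic (S T : topologicalType) : Prop :=
  exists (f : S -> T) (g : T -> S),
    [/\ cancel f g, cancel g f, continuous f & continuous g].

(* set_type Y carries the subspace topology inherited from T. *)
Definition contains_copy (T S : topologicalType) : Prop :=
  exists Y : set T, homeomorphic S (set_type Y).

Definition CL (X : topologicalType) : Type :=
  set_type [set A : set X | closed A /\ A !=set0].

Section fell.
Variable X : topologicalType.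

Definition hit (M : set X) : set (CL X) := [set A | set_val A `&` M !=set0].

Definition inside (M : set X) : set (CL X) := [set A | set_val A `<=` M].

Definition fell_subbase : set (set (CL X)) :=
  [set hit U | U in open] `|` [set inside (~` K) | K in compact].

Definition fell : Type := CL X.

HB.instance Definition _ := Choice.on fell.
HB.instance Definition _ :=
  @isSubBaseTopological.Build fell (set (CL X)) fell_subbase id.

End fell.

(* A well-ordering of the uncountable type set nat is fixed; omega1 is the
   initial segment of those points which have only countably many
   predecessors.  The lemmas omega1_wf, omega1_uncountable and
   omega1_segment_countable characterize it up to order isomorphism. *)
Definition wole : rel (set nat) := sval (well_ordering_principle (set nat)).

Definition omega1 : Type :=
  set_type [set x : set nat | countable [set y | wole y x /\ y <> x]].

Lemma wole_min (A : set (set nat)) :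
  A !=set0 -> exists2 x, A x & forall y, A y -> wole x y.
Proof.
move=> [a Aa]; have [|x [[xA xle] _]] :=
  svalP (well_ordering_principle (set nat)) (mem A).
  by exists a; exact/mem_set.
by exists x; [exact/set_mem|move=> y Ay; apply: xle; exact/mem_set].
Qed.

Lemma wole_total : total wole.
Proof.
move=> x y; have [|z [->|->] zle] := @wole_min [set x; y].
- by exists x; left.
- by rewrite (zle y)//; right.
- by rewrite (zle x) ?orbT//; left.
Qed.

Lemma wole_anti : antisymmetric wole.
Proof.
move=> x y /andP[xy yx].
have [|z [_ zu]] := svalP (well_ordering_principle (set nat)) (mem [set x; y]).
  by exists x; apply/mem_set; left.
have xx : wole x x by have := wole_total x x; rewrite orbb.
have yy : wole y y by have := wole_total y y; rewrite orbb.
rewrite -(zu x) ?(zu y)//; split=> [|t /set_mem[]->//].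
- by apply/mem_set; right.
- by apply/mem_set; left.
Qed.

Lemma wole_trans : transitive wole.
Proof.
move=> y x z xy yz.
have [|t [[->|->]|->] tle] := @wole_min [set x; y; z].
- by exists x; left; left.
- by apply: tle; right.
- have yx : wole y x by apply: tle; left; left.
  by have -> : x = y by apply: wole_anti; rewrite xy yx.
- have zy : wole z y by apply: tle; left; right.
  by have <- : y = z by apply: wole_anti; rewrite yz zy.
Qed.

Fact omega1_display : Order.disp_t. Proof. exact: Order.Disp tt tt. Qed.

Definition omega1_le (x y : omega1) : bool := wole (set_val x) (set_val y).

Lemma omega1_le_anti : antisymmetric omega1_le.
Proof. by move=> x y /wole_anti/val_inj. Qed.

Lemma omega1_le_trans : transitive omega1_le.
Proof. by move=> y x z; exact: wole_trans. Qed.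

Lemma omega1_le_total : total omega1_le.
Proof. by move=> x y; exact: wole_total. Qed.

HB.instance Definition _ := Choice.on omega1.
HB.instance Definition _ := @Order.isOrder.Build omega1_display omega1
  omega1_le _ _ _ (fun _ _ => erefl) (fun _ _ => erefl) (fun _ _ => erefl)
  omega1_le_anti omega1_le_trans omega1_le_total.

Lemma omega1_wf (A : set omega1) :
  A !=set0 -> exists2 x, A x & forall y, A y -> (x <= y)%O.
Proof.
move=> [a Aa]; have [|_ [x Ax <-] xle] := @wole_min (set_val @` A).
  by exists (set_val a), a.
by exists x => // y Ay; apply: xle; exists y.
Qed.

Lemma omega1_segment_countable (x : omega1) :
  countable [set y : omega1 | (y < x)%O].
Proof.
have /countable_injP[f f_inj] :
    countable [set y | wole y (set_val x) /\ y <> set_val x].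
  exact: set_valP x.
have sub (y : omega1) : (y < x)%O ->
    set_val y \in [set y | wole y (set_val x) /\ y <> set_val x].
  by rewrite lt_neqAle inE => /andP[/eqP yx xy]; split => // /val_inj.
apply/countable_injP; exists (f \o set_val) => y z /set_mem yx /set_mem zx.
by move/(f_inj _ _ (sub _ yx) (sub _ zx))/val_inj.
Qed.

Lemma omega1_uncountable : ~ countable [set: omega1].
Proof.
move=> /countable_injP[f f_inj].
pose C := [set x : set nat | countable [set y | wole y x /\ y <> x]].
have cC : countable C.
  pose g (x : set nat) := if pselect (C x) is left Cx
    then f (SigSub (mem_set Cx)) else 0.
  apply/countable_injP; exists g => x y /set_mem Cx /set_mem Cy.
  rewrite /g; case: pselect => // Cx'; case: pselect => // Cy'.
  by move/f_inj; rewrite !inE => /(_ I I) /(congr1 val).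
have CT : C = setT.
  apply: contrapT => CnT; have [|z /= nCz zle] := @wole_min (~` C).
    by apply/set0P/eqP; rewrite -setCT => /setC_inj.
  apply: nCz; apply: sub_countable cC.
  apply: subset_card_le => y /= [yz y_neq_z]; apply: contrapT => nCy.
  by apply: y_neq_z; apply: wole_anti; rewrite yz zle.
move: cC; rewrite CT => /countable_injP[h h_inj].
pose D := [set n | exists A, h A = n /\ ~ A n].
have nD : ~ D (h D).
  move=> /[dup] DD [A [hA nA]]; apply: nA; rewrite (_ : A = D)//.
  by apply: h_inj; rewrite ?inE.
by apply: (nD); exists D.
Qed.

(* omega1 with a greatest element, None, adjoined. *)
Definition omega1_succ : Type := option omega1.

Definition omega1_succ_le (x y : omega1_succ) : bool :=
  match x, y with
  | _, None => true
  | None, Some _ => false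
  | Some a, Some b => (a <= b)%O
  end.

Lemma omega1_succ_le_anti : antisymmetric omega1_succ_le.
Proof. by move=> [a|] [b|]//= /le_anti ->. Qed.

Lemma omega1_succ_le_trans : transitive omega1_succ_le.
Proof. by move=> [b|] [a|] [c|]//=; exact: le_trans. Qed.

Lemma omega1_succ_le_total : total omega1_succ_le.
Proof. by move=> [a|] [b|]//=; exact: le_total. Qed.

HB.instance Definition _ := Choice.on omega1_succ.
HB.instance Definition _ := @Order.isOrder.Build omega1_display omega1_succ
  omega1_succ_le _ _ _ (fun _ _ => erefl) (fun _ _ => erefl)
  (fun _ _ => erefl) omega1_succ_le_anti omega1_succ_le_trans
  omega1_succ_le_total.

(* Main.v *)
Require Import Defs.
From mathcomp Require Import all_boot all_order.
From mathcomp Require Import interval finmap all_classical topology.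

(** A closed discrete set [D] sees the Fell topology of [X] as the topology of
    pointwise convergence of characteristic functions.  Every subset of [D] is
    closed in [X] and is cut out of [D] by an open set, so that containing a
    given point of [D] is an open condition on a closed set; a compact set
    meets [D] in finitely many points ([compact_closed_discrete_finite]), so
    that avoiding it amounts, inside [D], to avoiding finitely many points.
    Hence the nonempty subsets of [D] form a copy of the Cantor cube over [D]
    with the point 0 removed.

    The ordinals up to [omega1] embed in the Cantor cube over [omega1]: to [x]
    corresponds the set of the countable ordinals [b < x].  The half-lines
    [b < x] and [x <= b], for countable [b], are open and generate the order
    topology ([omega1_succ_continuous]).  Taking this embedding in each
    coordinate, the [I]-th power of [omega1 + 1] embeds in the Cantor cube over
    [I * omega1], and from there in the hyperspace as soon as [I * omega1]
    injects into [D] with at least one point of [D] left over.  That point is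
    added to all sets of the image, in order to make them nonempty
    ([fell_contains_power]).

    What remains is cardinal arithmetic: [omega1 * omega1] injects into every
    uncountable set ([omega1_square_inj]).  A transfinite recursion chooses
    [omega1] pairwise disjoint sequences in [D]; the pairs of ordinals with
    maximum [c] are countably many, and are sent into the [c]-th sequence.  The
    power with exponent [nat] is obtained by restricting the first factor to a
    sequence of ordinals. *)

Set Implicit Arguments.
Unset Strict Implicit.
Unset Printing Implicit Defensive.

Import Order.TTheory.
Local Open Scope classical_set_scope.

Local Notation Omega := (order_topology omega1_succ).

(** * Continuity tested on subbases *)

Lemma fell_continuous (S X : topologicalType) (f : S -> fell X) :
  (forall B, fell_subbase B -> open (f @^-1` B)) -> continuous f.
Proof.
move=> fo x A /=; rewrite nbhsE => -[_ [[B sB <-] [C BC Cx]] sUA].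
rewrite nbhs_filterE; apply: filterS sUA _; apply: (@filterS _ _ _ C).
  by move=> y Cy; exists C.
have /sB [E sE IE] := BC; rewrite -IE; apply: filter_bigI => G GE.
have /sE := GE; rewrite inE => /fo oG.
apply: (@open_nbhs_nbhs S x (f @^-1` G)); split => //=.
by move: Cx; rewrite -IE => /(_ _ GE).
Qed.

Lemma hit_open (X : topologicalType) (U : set X) :
  open U -> open (hit U : set (fell X)).
Proof.
move=> oU; exists [set hit U]; last by rewrite bigcup_set1.
move=> _ ->; exists [fset (hit U : set (fell X))]%fset.
  by move=> B /fset1P ->; rewrite inE; left; exists U.
by rewrite set_fset1 bigcap_set1.
Qed.

Lemma miss_open (X : topologicalType) (K : set X) :
  compact K -> open (inside (~` K) : set (fell X)).
Proof.
move=> cK; exists [set inside (~` K)]; last by rewrite bigcup_set1.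
move=> _ ->; exists [fset (inside (~` K) : set (fell X))]%fset.
  by move=> B /fset1P ->; rewrite inE; right; exists K.
by rewrite set_fset1 bigcap_set1.
Qed.

Lemma ptws_continuous (I : Type) (S T : topologicalType)
    (g : S -> {ptws I -> T}) :
  (forall i, continuous (fun s => g s i)) -> continuous g.
Proof.
move=> gc x; apply/cvg_sup => i A [_ [[W oW <-] Wx] /filterS]; apply.
by apply: gc; exact: open_nbhs_nbhs.
Qed.

Lemma ptws_eval_continuous (I : Type) (T : topologicalType) (i : I) :
  continuous (fun p : {ptws I -> T} => p i).
Proof. exact: (@proj_continuous {classic I} (fun=> T) i). Qed.

Lemma order_continuous d (T : orderType d) (S : topologicalType)
    (g : S -> order_topology T) :
  (forall a : T, open [set s | (a < g s)%O]) ->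
  (forall a : T, open [set s | (g s < a)%O]) ->
  continuous g.
Proof.
move=> gr gl x A; rewrite /= order_nbhs_itv => -[i [oi xi] /filterS]; apply.
apply: (@open_nbhs_nbhs S x (g @^-1` [set` i])); split => //.
case: i oi xi => [[[] a|[]] [[] b|[]]] //= _ _.
- rewrite (_ : _ @^-1` _ =
    [set s | (a < g s)%O] `&` [set s | (g s < b)%O]); first exact: openI.
  by apply/seteqP; split=> s /=; rewrite in_itv /= => /andP.
- rewrite (_ : _ @^-1` _ = [set s | (a < g s)%O]) //.
  by apply/seteqP; split=> s /=; rewrite in_itv /= ?andbT.
- rewrite (_ : _ @^-1` _ = [set s | (g s < b)%O]) //.
- rewrite (_ : _ @^-1` _ = setT); first exact: openT.
  by apply/seteqP; split=> s.
Qed.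

(** * Uncountable sets *)

Lemma countableU (T : Type) (A B : set T) :
  countable A -> countable B -> countable (A `|` B).
Proof.
move=> cA cB; rewrite -bigcup2inE.
by apply: bigcup_countable => // -[|[|n]].
Qed.

Lemma uncountable_setD (T : Type) (A B : set T) :
  ~ countable A -> countable B -> ~ countable (A `\` B).
Proof.
move=> ncA cB cAB; apply: ncA; apply: sub_countable (countableU cB cAB).
apply: subset_card_le => x Ax.
by have [Bx|nBx] := pselect (B x); [left|right].
Qed.

Lemma infinite_set_nat_inj (T : Type) (A : set T) :
  infinite_set A -> exists2 f : nat -> T, injective f & forall n, A (f n).
Proof.
move=> /infiniteP/card_leP[f].
exists (fun n => set_val (f (SigSub (mem_set (I : [set: nat] n))))).
  move=> m n /val_inj fmn.
  exact: (congr1 val (@inj _ _ setT f _ _ (mem_set I) (mem_set I) fmn)).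
by move=> n; exact: set_valP.
Qed.

Lemma uncountable_nat_inj (T : Type) (A : set T) :
  ~ countable A -> exists2 f : nat -> T, injective f & forall n, A (f n).
Proof.
by move=> ncA; apply: infinite_set_nat_inj => /finite_set_countable.
Qed.

Lemma omega1_initial_countable (x : omega1) :
  countable [set y : omega1 | (y <= x)%O].
Proof.
have := countableU (countable1 x) (omega1_segment_countable x).
rewrite (_ : _ `|` _ = [set y : omega1 | (y <= x)%O]) //.
apply/seteqP; split=> y /=; first by case=> [->|/ltW].
by rewrite le_eqVlt => /orP[/eqP ->|yx]; [left|right].
Qed.

Lemma omega1_lt_wf : well_founded (fun x y : omega1 => (x < y)%O).
Proof.
move=> x; apply: contrapT => nx.
pose lt1 (y z : omega1) : Prop := (y < z)%O.
have [|y ny ymin] := @omega1_wf [set y | ~ Acc lt1 y]; first by exists x.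
apply: ny; constructor => z zy; apply: contrapT => /ymin.
by rewrite leNgt zy.
Qed.

(** At stage [a] the ranges of the earlier sequences have a countable union, so
    that the rest of [D] is still uncountable and contains a new sequence.
    Choosing a whole sequence at each stage, rather than a point, leaves room
    for countably many objects per ordinal. *)
Lemma disjoint_sequences (T : Type) (D : set T) : ~ countable D ->
  exists F : omega1 -> nat -> T, (forall a n, D (F a n)) /\
    (forall a b m n, F a m = F b n -> a = b /\ m = n).
Proof.
move=> ncD.
pose fresh (B : set T) (f : nat -> T) :=
  injective f /\ forall n, (D `\` B) (f n).
(* The implication makes [pick] total; it is applied to countable [B] only. *)
have /choice[pick pickP] B : exists f, countable B -> fresh B f.
  have [cB|ncB] := pselect (countable B); last first.
    by have [f _ _] := uncountable_nat_inj ncD; exists f.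
  have [f f_inj fDB] := uncountable_nat_inj (uncountable_setD ncD cB).
  by exists f.
pose step (a : omega1) (rec : forall b : omega1, (b < a)%O -> nat -> T) :=
  pick [set x | exists b (ba : (b < a)%O) n, rec b ba n = x].
pose F := Fix omega1_lt_wf (fun=> nat -> T) step.
have FE a : F a = pick [set x | exists b (ba : (b < a)%O) n, F b n = x].
  rewrite /F Fix_eq // => c f g fg; congr pick.
  by apply/seteqP; split=> x [b [bc [n <-]]]; exists b, bc, n; rewrite fg.
have Ffresh a :
    fresh (\bigcup_(b in [set b : omega1 | (b < a)%O]) range (F b)) (F a).
  rewrite FE (_ : [set x | _] =
    \bigcup_(b in [set b : omega1 | (b < a)%O]) range (F b)).
    apply/pickP/bigcup_countable; first exact: omega1_segment_countable.
    by move=> b _; apply: sub_countable (card_image_le _ _) _.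
  apply/seteqP; split=> x.
    by case=> b [ba [n <-]]; exists b => //; exists n.
  by case=> b /= ba [n _ <-]; exists b, ba, n.
exists F; split=> [a n|a b m n]; first by have [_ /(_ n)[]] := Ffresh a.
wlog ab : a b m n / (a <= b)%O => [H|].
  have [|/ltW ba /esym] := leP a b; first exact: H.
  by move=> /(H _ _ _ _ ba)[].
move: ab; rewrite le_eqVlt => /orP[/eqP -> Fmn|ab Fab].
  by split=> //; have [+ _] := Ffresh b; exact.
by have [_ /(_ n)[_ []]] := Ffresh b; exists a => //; exists m.
Qed.

(** The pairs are sorted by their maximum [c]: those with both entries at most
    [c] are countably many, so an injection [e c] of them into [nat] tells which
    term of the [c]-th sequence to use. *)
Lemma omega1_square_inj (T : Type) (D : set T) : ~ countable D ->
  exists2 h : omega1 * omega1 -> T, injective h & forall q, D (h q).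
Proof.
move=> /disjoint_sequences[F [FD F_inj]].
have /choice[e e_inj] c : exists e : omega1 * omega1 -> nat,
    {in [set y : omega1 | (y <= c)%O] `*` [set y : omega1 | (y <= c)%O] &,
      injective e}.
  by apply/countable_injP/countableX; exact: omega1_initial_countable.
exists (fun q => F (Order.max q.1 q.2) (e (Order.max q.1 q.2) q)) => // q r.
move=> /F_inj[qr]; rewrite -qr; apply: e_inj; rewrite inE /=.
  by rewrite !le_max !lexx orbT.
by rewrite qr !le_max !lexx orbT.
Qed.

(** * The space of ordinals up to omega1 *)

Lemma le_Some (a b : omega1) :
  ((Some a : Omega) <= (Some b : Omega))%O = (a <= b)%O.
Proof. by []. Qed.

Lemma lt_Some (a b : omega1) :
  ((Some a : Omega) < (Some b : Omega))%O = (a < b)%O.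
Proof. by rewrite !ltNge. Qed.

Lemma omega1_succP (x : omega1) :
  exists y : omega1, forall z : omega1, (z <= x)%O = (z < y)%O.
Proof.
have [|y xy ymin] := @omega1_wf [set y | (x < y)%O].
  apply: contrapT => nx; apply: omega1_uncountable.
  rewrite (_ : setT = [set y : omega1 | (y <= x)%O]).
    exact: omega1_initial_countable.
  apply/seteqP; split=> y //= _; rewrite leNgt; apply/negP => xy.
  by apply: nx; exists y.
exists y => z; apply/idP/idP => [zx|zy]; first exact: le_lt_trans zx xy.
by rewrite leNgt; apply: contraL zy => /ymin; rewrite -leNgt.
Qed.

Lemma open_gt_Some (b : omega1) :
  open [set x : Omega | ((Some b : Omega) < x)%O].
Proof.
rewrite (_ : [set x | _] = [set` `](Some b : Omega), +oo[%O]).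
  exact: rray_open.
by apply/seteqP; split=> x /=; rewrite in_itv /= andbT.
Qed.

(** This half-line with an endpoint is open because it consists of the points
    below the successor of [b]. *)
Lemma open_le_Some (b : omega1) :
  open [set x : Omega | (x <= (Some b : Omega))%O].
Proof.
have [c bc] := omega1_succP b.
rewrite (_ : [set x | _] = [set` `]-oo, (Some c : Omega)[%O]).
  exact: lray_open.
by apply/seteqP; split=> -[a|] //=; rewrite in_itv /= lt_Some le_Some bc.
Qed.

(** Ordinals are compared as sets of smaller ordinals; here all the smaller
    ordinals are countable, because nothing lies above [None]. *)
Lemma omega1_succ_leP (x y : Omega) :
  (forall b : omega1, ((Some b : Omega) < x -> (Some b : Omega) < y)%O) ->
  (x <= y)%O.
Proof.
move=> xy; rewrite leNgt; apply/negP => yx.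
case: y yx xy => [c cx /(_ c cx)|]; first by rewrite ltxx.
by case: x.
Qed.

(** The open initial segment below [a] is the union of the closed segments up
    to the points [c < a], and such a [c] is never the top element. *)
Lemma omega1_succ_continuous (S : topologicalType) (g : S -> Omega) :
  (forall b : omega1, open [set s | ((Some b : Omega) < g s)%O]) ->
  (forall b : omega1, open [set s | (g s <= (Some b : Omega))%O]) ->
  continuous g.
Proof.
move=> gt_open le_open; apply: order_continuous => -[b|].
- exact: gt_open.
- rewrite (_ : [set s | _] = set0); first exact: open0.
  by apply/seteqP; split=> s //=; case: (g s).
- rewrite (_ : [set s | _] = \bigcup_(c in [set c : omega1 | (c < b)%O])
      [set s | (g s <= (Some c : Omega))%O]); first exact: bigcup_open.
  apply/seteqP; split=> s /=.
    case gs: (g s) => [c|//]; rewrite lt_Some => cb.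
    by exists c; rewrite //= gs.
  by case=> c /= cb /le_lt_trans; apply; rewrite lt_Some.
- rewrite (_ : [set s | _] = \bigcup_c
      [set s | (g s <= (Some c : Omega))%O]); first exact: bigcup_open.
  apply/seteqP; split=> s /=.
    by case gs: (g s) => [c|//] _; exists c; rewrite //= gs.
  by case=> c /= _ /le_lt_trans; apply.
Qed.

(** * Closed discrete sets *)

Lemma discrete_trace (X : topologicalType) (D E : set X) :
  discrete_subset D -> E `<=` D -> exists2 U, open U & U `&` D = E.
Proof.
move=> dD ED; have [U oU UE] := dD (set_val @^-1` E); exists U => //.
apply/seteqP; split=> x.
  case=> Ux Dx; have /seteqP[sUE _] := UE.
  exact: (sUE (SigSub (mem_set Dx)) Ux).
move=> Ex; split; last exact: ED.
have /seteqP[_ sEU] := UE.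
exact: (sEU (SigSub (mem_set (ED _ Ex))) Ex).
Qed.

Lemma sub_closed_discrete (X : topologicalType) (D E : set X) :
  closed D -> discrete_subset D -> E `<=` D -> closed E.
Proof.
move=> cD dD ED; have [U oU UD] := discrete_trace dD (@subDsetl _ D E).
rewrite (_ : E = D `&` ~` U).
  by apply: closedI => //; exact: open_closedC.
apply/seteqP; split=> x.
  move=> Ex; split; first exact: ED.
  move=> Ux; have : (U `&` D) x by split=> //; exact: ED.
  by rewrite UD => -[].
case=> Dx nUx; apply: contrapT => nEx; apply: nUx.
by have : (D `\` E) x by []; rewrite -UD => -[].
Qed.

(** If the trace of [K] were infinite, its cofinite subsets would generate a
    proper filter, hence have a cluster point.  But every point of the space has
    a neighborhood without points of [D], except possibly the point itself. *)
Lemma compact_closed_discrete_finite (X : topologicalType) (D K : set X) :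
  closed D -> discrete_subset D -> compact K -> finite_set (K `&` D).
Proof.
move=> cD dD cK; apply: contrapT => infKD.
pose F : set_system X := [set A | finite_set ((K `&` D) `\` A)].
have FF : ProperFilter F.
  apply: Build_ProperFilter_ex.
    move=> A FA; apply: contrapT => nA; apply: infKD.
    rewrite (_ : K `&` D = (K `&` D) `\` A) //.
    apply/seteqP; split=> x; last by case.
    by move=> KDx; split=> // Ax; apply: nA; exists x.
  split.
  - by rewrite /F /= setDT.
  - by move=> A B FA FB; rewrite /F /= setDIr finite_setU.
  - by move=> A B AB; apply: sub_finite_set; exact: setDS.
have FKD : F (K `&` D) by rewrite /F /= setDv.
have [x [Kx clx]] := cK F FF (filterS (@subIsetl _ K D) FKD).
have [U oU UD] : exists2 U, nbhs x U & U `&` D `<=` [set x].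
  have [Dx|nDx] := pselect (D x).
    have [|U oU UD] := @discrete_trace _ D [set x] dD; first by move=> _ ->.
    exists U; last by rewrite UD.
    apply: open_nbhs_nbhs; split=> //.
    by have : [set x] x by []; rewrite -UD => -[].
  exists (~` D); last by rewrite setICl.
  by apply: open_nbhs_nbhs; split=> //; exact: closed_openC.
have FKDx : F ((K `&` D) `\ x).
  by rewrite /F /= setDD; apply: sub_finite_set (finite_set1 x) => y [].
by have [y [[[_ Dy] yx] Uy]] := clx _ _ FKDx oU; apply: yx; exact: UD.
Qed.

(** * Embedding the powers *)

(** Quantifying over all inverses [g] of [f] on its range makes it possible to
    check continuity from the equation that characterizes [g], without
    constructing it. *)
Lemma contains_copy_of_embedding (S T : topologicalType) (f : S -> T) :
  injective f -> continuous f ->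
  (forall g : set_type (range f) -> S,
    (forall y, f (g y) = set_val y) -> continuous g) ->
  contains_copy T S.
Proof.
move=> f_inj f_cont inv_cont; exists (range f).
pose F x : set_type (range f) := SigSub (mem_set (imageT f x)).
have /choice[g fg] (y : set_type (range f)) : exists x, f x = set_val y.
  by have [x _ xy] := set_valP y; exists x.
exists F, g; split.
- by move=> x; apply: f_inj; rewrite fg.
- by move=> y; apply: val_inj; rewrite /= fg.
- exact: continuous_comp_initial.
- exact: inv_cont.
Qed.

Section power.
Context (X : topologicalType) (I : Type) (D : set X).
Context (h : I * omega1 -> X) (d0 : X).
Context (cD : closed D) (dD : discrete_subset D).
Context (h_inj : injective h) (hD : forall q, (D `\ d0) (h q)) (Dd0 : D d0).
Local Notation power := {ptws I -> Omega}.

(** In coordinate [i], the copy of [omega1] indexed by [i] in [D] records the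
    Dedekind cut of [p i]; the spare point [d0] keeps the set nonempty when all
    these cuts are empty. *)
Definition cut_set (p : power) : set X :=
  d0 |` [set h q | q in [set q | ((Some q.2 : Omega) < p q.1)%O]].

Lemma cut_set_sub p : cut_set p `<=` D.
Proof. by move=> _ [->|[q _ <-]] //; have [] := hD q. Qed.

Lemma cut_setP p : [set A : set X | closed A /\ A !=set0] (cut_set p).
Proof.
split; first exact: sub_closed_discrete cD dD (@cut_set_sub p).
by exists d0; left.
Qed.

Definition cut (p : power) : fell X := SigSub (mem_set (cut_setP p)).

Lemma mem_cut p q : set_val (cut p) (h q) <-> ((Some q.2 : Omega) < p q.1)%O.
Proof.
split; last by move=> qp; right; exists q.
case=> [hq|[r rp /h_inj <-] //].
by have [_ []] := hD q.
Qed.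

Lemma cut_inj : injective cut.
Proof.
have cut_le p r : cut p = cut r -> forall i, (p i <= r i)%O.
  move=> pr i; apply: omega1_succ_leP => b /(mem_cut p (i, b)).
  by rewrite pr => /mem_cut.
move=> p r pr; apply/funext => i.
by apply/le_anti/andP; split; exact: cut_le.
Qed.

Lemma clopen_gt_Some (q : I * omega1) :
  clopen [set p : power | ((Some q.2 : Omega) < p q.1)%O].
Proof.
pose ev (p : power) := p q.1.
have ev_open A : open A -> open (ev @^-1` A).
  by move=> oA; apply: open_comp oA => p _; exact: ptws_eval_continuous.
split; first exact: (ev_open _ (open_gt_Some q.2)).
rewrite (_ : [set p | _] =
  ~` (ev @^-1` [set x | (x <= (Some q.2 : Omega))%O])).
  exact/open_closedC/ev_open/open_le_Some.
by apply/seteqP; split=> p /=; rewrite ltNge => /negP.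
Qed.

(** The case where the test set contains [d0] is trivial.  Otherwise, hitting
    an open set means containing one of its points [h q], a union of open
    conditions; missing a compact set means containing none of its points
    [h q], and as these are finitely many the condition is open. *)
Lemma cut_continuous : continuous cut.
Proof.
apply: fell_continuous => _ [[U oU <-]|[K cK <-]].
- have [Ud0|nUd0] := pselect (U d0).
    rewrite (_ : _ @^-1` _ = setT); first exact: openT.
    by apply/seteqP; split=> p // _; exists d0; split=> //; left.
  rewrite (_ : _ @^-1` _ = \bigcup_(q in h @^-1` U)
      [set p : power | ((Some q.2 : Omega) < p q.1)%O]).
    by apply: bigcup_open => q _; have [] := clopen_gt_Some q.
  apply/seteqP; split=> p.
    by case=> _ [[->//|[q qp <-]] Uhq]; exists q.
  by case=> q Uhq /mem_cut qp; exists (h q).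
- have [Kd0|nKd0] := pselect (K d0).
    rewrite (_ : _ @^-1` _ = set0); first exact: open0.
    by apply/seteqP; split=> p // /(_ d0); case=> //; left.
  rewrite (_ : _ @^-1` _ = ~` \bigcup_(q in h @^-1` (K `&` D))
      [set p : power | ((Some q.2 : Omega) < p q.1)%O]).
    apply/closed_openC/(@closed_bigcup _ {classic (I * omega1)}).
      apply: finite_preimage; first by move=> q r _ _; exact: h_inj.
      exact: compact_closed_discrete_finite.
    by move=> q _; have [] := clopen_gt_Some q.
  apply/seteqP; split=> p.
    by move=> pK [q [Khq _] /mem_cut/pK].
  move=> pK _ [->//|[q qp <-]] Khq; apply: pK; exists q => //.
  by split=> //; have [] := hD q.
Qed.

(** The two kinds of half-lines that generate the topology in coordinate [i] are
    the traces on the range of [cut] of basic Fell sets: hitting an open set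
    that isolates [h (i, b)] in [D], and missing the singleton of
    [h (i, b)]. *)
Lemma cut_inverse_continuous (g : set_type (range cut) -> power) :
  (forall y, cut (g y) = set_val y) -> continuous g.
Proof.
move=> cg; apply: ptws_continuous => i; apply: omega1_succ_continuous => b.
- have [|U oU UD] := @discrete_trace _ D [set h (i, b)] dD.
    by move=> _ ->; have [] := hD (i, b).
  exists (hit U); first exact: hit_open.
  apply/seteqP; split=> y /=; rewrite -cg.
    case=> x [cx Ux]; have : [set h (i, b)] x.
      by rewrite -UD; split=> //; exact: cut_set_sub cx.
    by move=> xE; move: cx; rewrite xE => /mem_cut.
  move=> bg; exists (h (i, b)); split; first exact/mem_cut.
  by have : [set h (i, b)] (h (i, b)) by []; rewrite -UD => -[].
- exists (inside (~` [set h (i, b)])); first exact/miss_open/compact_set1.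
  apply/seteqP; split=> y /=; rewrite -cg leNgt.
    by move=> gb; apply/negP => bg; apply: gb ((mem_cut (g y) (i, b)).2 bg) _.
  by move=> gb x cx xE; move: cx gb; rewrite xE => /mem_cut ->.
Qed.

Lemma fell_contains_power : contains_copy (fell X) power.
Proof.
exact: contains_copy_of_embedding cut_inj cut_continuous cut_inverse_continuous.
Qed.

End power.

Theorem theorem2p1 (X : topologicalType) :
  hausdorff_space X ->
  (exists D : set X, [/\ closed D, discrete_subset D & ~ countable D]) ->
  contains_copy (fell X) {ptws nat -> order_topology omega1_succ} /\
  contains_copy (fell X) {ptws omega1 -> order_topology omega1_succ}.
Proof.
move=> _ [D [cD dD ncD]].
have [d0 Dd0] : D !=set0 by apply: infinite_setN0 => /finite_set_countable.
have [h h_inj hD] := omega1_square_inj (uncountable_setD ncD (countable1 d0)).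
split; last exact: (@fell_contains_power X omega1 D h d0).
have [k k_inj _] := uncountable_nat_inj omega1_uncountable.
apply: (@fell_contains_power X nat D (fun q => h (k q.1, q.2)) d0) => //.
by move=> [m b] [n c] /h_inj[/k_inj -> ->].
Qed.
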